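(* Let $\mathcal{X}\subseteq\mathbb{R}^n$ be closed and let $f:\mathcal{X}\to\mathbb{R}$ be an objective function that attains a unique global minimum at the origin; write $x^*=0$ for the minimizer. Let $\pi_0\in\mathcal{P}(\mathcal{X})$ be an initial search distribution, and define the sequence of search distributions $\{\pi_g\}$ by $\pi_g\propto \pi_0\cdot e^{-gf}$. Then the following hold. (a) The sequence $\{\pi_g\}$ collapses in the limit on the Dirac delta distribution in the sense that $$\lim_{g\to\infty}\pi_g(x)=\begin{cases}\infty, & x=x^*,\\ 0, & x\neq x^*.\end{cases}$$ (b) The function $g\mapsto \mathbb{E}_{\pi_g}[f]$ is monotonically decreasing regardless of $\pi_0$: $$\mathbb{E}_{\pi_{g+1}}[f]<\mathbb{E}_{\pi_g}[f].$$ (c) If $\pi_0$ is chosen uniform on $\mathcal{X}$, the function $g\mapsto \mathbb{H}[\pi_g]$ is monotonically decreasing: $$\mathbb{H}[\pi_{g+1}]<\mathbb{H}[\pi_g].$$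
   Context: $\mathcal{P}(\mathcal{X})$ denotes the set of continuous probability density functions on the closed set $\mathcal{X}\subseteq\mathbb{R}^n$. The notation $\pi\propto p$ with $\pi\in\mathcal{P}(\mathcal{X})$ means that $\pi$ equals $p$ up to a normalization constant. $\mathbb{E}_\pi[f]=\int_{\mathcal{X}}\pi(x)f(x)\,dx$ is the expectation of $f$ under the density $\pi$, and $\mathbb{H}[\pi]=\mathbb{E}_\pi[-\log\pi]=-\int_{\mathcal{X}}\pi(x)\log\pi(x)\,dx$ is the differential entropy. The index $g=0,1,2,\dots$ is the generation counter.
   Formalization: Added: n ≥ 1; in (a), π_0(0) > 0 and every neighbourhood of 0 meets 𝒳 in positive volume; in (b), (c), either this or f not π_0-almost surely constant. Without these the claims fail, e.g. 𝒳 = {0}∪[1,2], f(0)=0, f=1 on [1,2], π_0 uniform. *)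

(* Defs.v *)
(* MathComp-Analysis; the real numbers are an arbitrary R : realType. *)
From HB Require Import structures.
From mathcomp Require Import all_boot all_order all_algebra.
From mathcomp Require Import all_classical all_reals all_analysis.

Set Implicit Arguments.
Unset Strict Implicit.
Unset Printing Implicit Defensive.
Import Order.TTheory GRing.Theory Num.Theory.
Import numFieldNormedType.Exports.
Local Open Scope classical_set_scope.
Local Open Scope ring_scope.

(* Lebesgue measure on R^n = 'rV[R]_n.  The library has Lebesgue measure on R
   and binary products only: we iterate the product on n-tuples (product
   sigma-algebra) and transport the result to 'rV[R]_n, whose measurable sets
   are the Borel sets of its usual topology.  [lebesgue_rVX] evaluates it on
   boxes. *)

Section image_measure.
Context d1 d2 (T1 : measurableType d1) (T2 : measurableType d2) (R : realType).

(* pushforward, with the measurability proof as an argument so that the image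
   is canonically a measure *)
Definition image_measure (m : {measure set T1 -> \bar R}) (f : T1 -> T2)
    (mf : measurable_fun setT f) : set T2 -> \bar R :=
  pushforward m f.

Variables (m : {measure set T1 -> \bar R}) (f : T1 -> T2).
Hypothesis mf : measurable_fun setT f.

Let image0 : image_measure m mf set0 = 0%E.
Proof. by rewrite /image_measure /pushforward preimage_set0 measure0. Qed.

Let image_ge0 A : (0 <= image_measure m mf A)%E.
Proof. exact: measure_ge0. Qed.

Let image_sigma_additive : semi_sigma_additive (image_measure m mf).
Proof.
move=> F mF tF mUF; rewrite /image_measure /pushforward preimage_bigcup.
apply: measure_semi_sigma_additive.
- by move=> n; rewrite -[X in measurable X]setTI; exact: mf.
- apply/trivIsetP => /= i j _ _ ij; rewrite -preimage_setI.
  by move/trivIsetP : tF => /(_ _ _ _ _ ij) ->//; rewrite preimage_set0.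
- by rewrite -preimage_bigcup -[X in measurable X]setTI; exact: mf.
Qed.

HB.instance Definition _ := isMeasure.Build _ _ _ (image_measure m mf)
  image0 image_ge0 image_sigma_additive.

End image_measure.

Lemma image_measure_sigma_finite d1 d2 (T1 : measurableType d1)
    (T2 : measurableType d2) (R : realType) (m : {measure set T1 -> \bar R})
    (f : T1 -> T2) (mf : measurable_fun setT f) (g : T2 -> T1) :
  sigma_finite setT m -> measurable_fun setT g -> cancel f g ->
  sigma_finite setT (image_measure m mf).
Proof.
move=> [F UF mF] mg fK.
exists (fun k => g @^-1` F k); first by rewrite -preimage_bigcup -UF.
move=> k; have [mFk Fk_oo] := mF k; split.
  by rewrite -[X in measurable X]setTI; exact: mg.
rewrite /image_measure /pushforward -comp_preimage.
by rewrite (_ : g \o f = id) ?preimage_id//; apply/funext => x /=; rewrite fK.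
Qed.

(* The library's sigma-finite structure on products is shadowed by the one it
   declares for products of subprobabilities. *)
Lemma product_measure_sigma_finite d1 d2 (T1 : measurableType d1)
    (T2 : measurableType d2) (R : realType)
    (m1 : {sigma_finite_measure set T1 -> \bar R})
    (m2 : {sigma_finite_measure set T2 -> \bar R}) :
  sigma_finite setT (m1 \x m2)%E.
Proof.
have /sigma_finiteP[F [TF ndF Foo]] := sigma_finiteT m1.
have /sigma_finiteP[G [TG ndG Goo]] := sigma_finiteT m2.
exists (fun n => F n `*` G n).
  rewrite -setXTT TF TG predeqE => -[x y]; split.
    move=> [/= [n _ Fnx] [k _ Gky]]; exists (maxn n k) => //; split.
    - by move: x Fnx; exact/subsetPset/ndF/leq_maxl.
    - by move: y Gky; exact/subsetPset/ndG/leq_maxr.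
  by move=> [n _ []/= ? ?]; split; exists n.
move=> k; have [? ?] := Foo k; have [? ?] := Goo k.
split; first exact: measurableX.
by rewrite product_measure1E// lte_mul_pinfty// ge0_fin_numE.
Qed.

Section lebesgue_tuple.
Context {R : realType}.
Local Notation T := (measurableTypeR R).

Definition tcons n (p : T * n.-tuple T) : n.+1.-tuple T :=
  [tuple of p.1 :: p.2].

Definition tuncons n (t : n.+1.-tuple T) : T * n.-tuple T :=
  (thead t, [tuple of behead t]).

Lemma tconsK n : cancel (@tcons n) (@tuncons n).
Proof.
by move=> [x t]; rewrite /tuncons /tcons theadE /=; congr pair; exact/val_inj.
Qed.

Lemma measurable_tcons n : measurable_fun setT (@tcons n).
Proof. exact: measurable_cons. Qed.

Lemma measurable_tuncons n : measurable_fun setT (@tuncons n).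
Proof.
apply/measurable_fun_pairP; split; last exact: measurable_behead.
exact: (measurable_tnth ord0).
Qed.

Definition lebesgue_tuple_step n
    (mu : {sigma_finite_measure set (n.-tuple T) -> \bar R}) :
    set (n.+1.-tuple T) -> \bar R :=
  image_measure (@lebesgue_measure R \x mu)%E (@measurable_tcons n).

HB.instance Definition _ n mu := Measure.on (@lebesgue_tuple_step n mu).

Lemma lebesgue_tuple_step_sigma_finite n mu :
  sigma_finite setT (@lebesgue_tuple_step n mu).
Proof.
apply: (image_measure_sigma_finite _ _ (@measurable_tuncons n) (@tconsK n)).
exact: product_measure_sigma_finite.
Qed.

HB.instance Definition _ n mu := Measure_isSigmaFinite.Build _ _ _
  (@lebesgue_tuple_step n mu) (@lebesgue_tuple_step_sigma_finite n mu).

Fixpoint lebesgue_tuple n :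
    {sigma_finite_measure set (n.-tuple T) -> \bar R} :=
  if n is k.+1 then lebesgue_tuple_step (lebesgue_tuple k)
  else \d_([tuple] : 0.-tuple T).

Lemma lebesgue_tupleX n (A : 'I_n -> set T) : (forall i, measurable (A i)) ->
  lebesgue_tuple n [set t | forall i, A i (tnth t i)] =
  (\prod_(i < n) lebesgue_measure (A i))%E.
Proof.
elim: n A => [A _|n IH A mA].
  rewrite big_ord0 /= diracE (_ : _ \in _)//; apply/mem_set => -[] //.
rewrite big_ord_recl -IH; last by move=> i; exact: mA.
rewrite /= /lebesgue_tuple_step /image_measure /pushforward.
rewrite -product_measure1E//.
  congr product_measure1; apply/seteqP; split => [[x t] /= At|[x t] /= [A0 At] i].
    split; first exact: (At ord0).
    by move=> i; have := At (lift ord0 i); rewrite tnthS.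
  by case: (unliftP ord0 i) => [j|] ->; rewrite ?tnthS//=; exact: At.
rewrite (_ : mkset _ =
    \bigcap_i [set t | A (lift ord0 i) (tnth t i)]); last first.
  by apply/seteqP; split => [t + i _|t + i]; apply.
apply: fin_bigcap_measurable => // i _.
by rewrite -[X in measurable X]setTI; exact: measurable_tnth.
Qed.

End lebesgue_tuple.

Section borel_rV.
Context {R : realType} {n : nat}.

Let rV_set0 : <<s @open 'rV[R]_n >> set0. Proof. exact: sigma_algebra0. Qed.

Let rV_setC A : <<s @open 'rV[R]_n >> A -> <<s @open 'rV[R]_n >> (~` A).
Proof. exact: sigma_algebraC. Qed.

Let rV_bigcup (F : _^nat) : (forall i, <<s @open 'rV[R]_n >> (F i)) ->
  <<s @open 'rV[R]_n >> (\bigcup_i (F i)).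
Proof. exact: sigma_algebra_bigcup. Qed.

HB.instance Definition _ := @isMeasurable.Build (sigma_display (@open 'rV[R]_n))
  'rV[R]_n <<s @open 'rV[R]_n >> rV_set0 rV_setC rV_bigcup.

Local Notation T := (measurableTypeR R).

Definition row_of_tuple (t : n.-tuple T) : 'rV[R]_n := \row_i tnth t i.
Definition tuple_of_row (v : 'rV[R]_n) : n.-tuple T := [tuple v ord0 i | i < n].

Lemma row_of_tupleK : cancel row_of_tuple tuple_of_row.
Proof. by move=> t; apply: eq_from_tnth => i; rewrite tnth_mktuple mxE. Qed.

Lemma measurable_row_of_tuple : measurable_fun setT row_of_tuple.
Proof.
apply: (@measurability _ _ _ _ _ _ (@open 'rV[R]_n)) => // _ [U oU <-].
rewrite setTI.
pose box (q : 'rV[rat]_n * nat) (x : 'I_n -> R) :=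
  forall i, `|x i - ratr (q.1 ord0 i)| < q.2.+1%:R^-1.
pose D := [set q | forall v : 'rV[R]_n, box q (v ord0) -> U v].
rewrite (_ : _ @^-1` _ = \bigcup_(q in D) [set t | box q (tnth t)]); last first.
  apply/seteqP; split => [t /= Ut|t [q Dq qt]]; last first.
    by apply: Dq => i; rewrite mxE; exact: qt.
  have /nbhs_ballP[e /= e0 eU] : nbhs (row_of_tuple t) U.
    by apply: open_nbhs_nbhs; split.
  have e20 : 0 < e / 2 by rewrite divr_gt0.
  have [k ke] : exists k, k.+1%:R^-1 < e / 2.
    exists (Num.trunc (e / 2)^-1).
    by rewrite invf_plt ?posrE//; exact: truncnS_gt.
  have k0 : 0 < k.+1%:R^-1 :> R by rewrite invr_gt0.
  have /choice[q tq] : forall i, exists q : rat,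
      `|tnth t i - ratr q| < k.+1%:R^-1.
    move=> i; have [|q] := @rat_in_itvoo R (tnth t i) (tnth t i + k.+1%:R^-1).
      by rewrite ltrDl.
    rewrite in_itv /= => /andP[tq qt]; exists q.
    by rewrite distrC ger0_norm ?subr_ge0 ?(ltW tq)// ltrBlDl.
  exists (\row_i q i, k); last by move=> i /=; rewrite mxE.
  move=> v /= vq; apply: eU; split=> // i j; rewrite !mxE ord1.
  rewrite /ball /= -(subrKA (ratr (q j))) (le_lt_trans (ler_normD _ _))//.
  rewrite [ltRHS]splitr ltrD ?(lt_trans (tq j))//.
  by have := vq j; rewrite /= mxE distrC => /lt_trans; exact.
rewrite bigcup_mkcond; apply: countable_bigcupT_measurable => [|q].
  exact: countableP.
case: ifPn => // _.
rewrite (_ : mkset _ =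
  \bigcap_i [set t | `|tnth t i - ratr (q.1 ord0 i)| < q.2.+1%:R^-1]); last first.
  by apply/seteqP; split => [t + i _|t + i]; apply.
apply: fin_bigcap_measurable => // i _.
rewrite (_ : mkset _ = @tnth _ _ ^~ i @^-1`
    `]ratr (q.1 ord0 i) - q.2.+1%:R^-1, ratr (q.1 ord0 i) + q.2.+1%:R^-1[);
  last by apply/seteqP; split => t /=; rewrite in_itv /= ltr_distl.
by rewrite -[X in measurable X]setTI; exact: measurable_tnth.
Qed.

Lemma measurable_tuple_of_row : measurable_fun setT tuple_of_row.
Proof.
apply/measurable_fun_tnthP => i.
apply: (measurability _ (measurable_realfun.RGenOpens.measurableE R)) => _ [_ [a [b ->]] <-].
rewrite setTI (_ : _ \o _ = fun v : 'rV[R]_n => v ord0 i); last first.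
  by apply/funext => v /=; rewrite tnth_mktuple.
apply: sub_sigma_algebra; apply: open_comp; last exact: interval_open.
by move=> v _; exact: coord_continuous.
Qed.

Definition lebesgue_rV : set 'rV[R]_n -> \bar R :=
  image_measure (lebesgue_tuple n) measurable_row_of_tuple.

HB.instance Definition _ := Measure.on lebesgue_rV.

Lemma lebesgue_rV_sigma_finite : sigma_finite setT lebesgue_rV.
Proof.
apply: (image_measure_sigma_finite _ _ measurable_tuple_of_row row_of_tupleK).
exact: sigma_finiteT.
Qed.

HB.instance Definition _ := Measure_isSigmaFinite.Build _ _ _
  lebesgue_rV lebesgue_rV_sigma_finite.

Lemma lebesgue_rVX (A : 'I_n -> set T) : (forall i, measurable (A i)) ->
  lebesgue_rV [set v | forall i, A i (v ord0 i)] =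
  (\prod_(i < n) lebesgue_measure (A i))%E.
Proof.
move=> mA; rewrite -lebesgue_tupleX// /lebesgue_rV /image_measure /pushforward.
by congr (lebesgue_tuple n _); apply/seteqP; split => t /= At i;
  have := At i; rewrite mxE.
Qed.

End borel_rV.

Section search_distributions.
Context {R : realType} {n : nat}.
Implicit Types (X : set 'rV[R]_n) (p q f : 'rV[R]_n -> R).

(* Functions are total on R^n, but only their values on X matter. *)
Definition is_density X p : Prop :=
  [/\ {within X, continuous p},
      forall x, X x -> 0 <= p x &
      (\int[lebesgue_rV]_(x in X) (p x)%:E = 1)%E].

Definition proportional X p q : Prop :=
  exists2 c : R, 0 < c & forall x, X x -> p x = c * q x.

(* Extended-real valued: the expectation of a function that is bounded below is
   always meaningful but may be +oo. *)
Definition density_expectation X p f : \bar R :=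
  (\int[lebesgue_rV]_(x in X) (p x * f x)%:E)%E.

(* Since ln 0 = 0 in the library, 0 * ln 0 = 0 as usual. *)
Definition differential_entropy X p : \bar R :=
  density_expectation X p (fun x => - ln (p x)).

(* For a density p this forces the value 1 / lebesgue_rV X. *)
Definition uniform_on X p : Prop := exists c : R, forall x, X x -> p x = c.

(* p is positive at a, and a belongs to the support of the restriction of
   Lebesgue measure to X (every neighbourhood of a in X has positive volume). *)
Definition charges X p (a : 'rV[R]_n) : Prop :=
  0 < p a /\
  forall U : set 'rV[R]_n, open U -> U a -> (0 < lebesgue_rV (X `&` U))%E.

(* f is constant almost surely under the density p on X. *)
Definition as_constant X p f : Prop :=
  exists c : R, {ae lebesgue_rV, forall x, X x -> 0 < p x -> f x = c}.

End search_distributions.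

(* Main.v *)
Require Import Defs.
From mathcomp Require Import all_boot all_order all_algebra.
From mathcomp Require Import all_classical all_reals all_analysis.
From mathcomp Require Import measurable_realfun.
From mathcomp Require Import ring lra.

(** Each generation is an exponential tilt of the previous one: on [X],
    [p g.+1 = p g * exp (m - f)] for a constant [m] depending on [g], the
    logarithm of the ratio of the two normalization constants.

    Monotonicity.  Write [q = p * exp t] with [t = m - f].  The integrands of
    the expectation and of the entropy under [p] and [q] differ by a multiple
    of [p - q], whose integral vanishes, plus [p] times a nonnegative function
    of [t] built from [t * (exp t - 1)] and [1 - exp t * (1 - t)].  Both
    expressions are positive except at [t = 0].  So the integrals decrease
    strictly unless [f = m] almost everywhere on [p > 0]
    ([integral_lt_of_le_add_null], [expectation_tilted_lt],
    [entropy_tilted_lt]).  The expectation under [p 0] may be infinite; all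
    later ones are finite because [s * exp (- s)] is bounded for [s >= 0].

    Non-constancy.  If [p 0] charges the minimizer, [f] cannot be almost surely
    constant: its constant value would be taken at points other than 0 and
    arbitrarily close to 0, where [f] is close to, but greater than, [f 0]
    ([charges_not_as_constant]).

    Concentration.  All normalization constants disappear from the quotients
    [p g y / p g x], which equal [p 0 y / p 0 x * exp (f x - f y) ^ g].
    Integrating in [y] over [X] for [x = 0] gives [1 / p g 0], which tends to 0
    by dominated convergence ([cvg_density_minimizer]).  For [x != 0],
    integrating over a set of positive mass on which [f < b < f x] gives
    a geometric bound on [p g x] ([cvg_density_elsewhere]).

    The objective [f] is an arbitrary function.  Measurability and continuity
    of [f] where [p 0 > 0] come from the densities, through
    [f = m + ln p - ln q] ([objective_ln]). *)

Import Order.TTheory GRing.Theory Num.Theory.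
Import numFieldNormedType.Exports.
Local Open Scope classical_set_scope.
Local Open Scope ring_scope.

(** * Strict comparison of integrals *)

Section integral_comparison.
Context {d} {T : measurableType d} {R : realType}.
Context {mu : {measure set T -> \bar R}} {D : set T}.
Hypothesis mD : measurable D.

Lemma ge0_integral0_ae {w : T -> R} :
  measurable_fun D w -> (forall x, D x -> 0 <= w x) ->
  (\int[mu]_(x in D) (w x)%:E = 0)%E -> {ae mu, forall x, D x -> w x = 0}.
Proof.
move=> mw w0 iw.
have mEw : measurable_fun D (EFin \o w) by exact/measurable_EFinP.
have /(ae_eq_integral_abs mu mD mEw) :
    (\int[mu]_(x in D) `|(EFin \o w) x| = 0)%E.
  by rewrite -[RHS]iw; apply: eq_integral => x /[!inE] Dx /=;
    rewrite ger0_norm ?w0.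
by apply: filterS => x + Dx => /(_ Dx) [].
Qed.

Lemma integral_pinfty {v : T -> \bar R} : measurable_fun D v ->
  mu.-integrable D v^\-%E -> ~ mu.-integrable D v ->
  (\int[mu]_(x in D) v x = +oo)%E.
Proof.
move=> mv ivn nv; rewrite integralE.
have -> : (\int[mu]_(x in D) v^\+ x = +oo)%E.
  apply/eqP; rewrite -leye_eq leNgt; apply/negP => vp_oo; apply: nv.
  rewrite (funeposneg v); apply: integrableB => //.
  apply/integrableP; split; first exact: measurable_funepos.
  by under eq_integral do rewrite gee0_abs//.
by have := integrable_fin_num mD ivn; case: (integral _ _ _).
Qed.

(** The null-integral correction [e] lets a pointwise comparison absorb the
    fact that two densities have the same mass.  If [v] is not integrable, its
    negative part still is, being dominated by that of [u - e], so that the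
    integral of [v] is [+oo]. *)
Lemma integral_lt_of_le_add_null {u v e : T -> R} :
  mu.-integrable D (EFin \o u) -> measurable_fun D v ->
  mu.-integrable D (EFin \o e) -> (\int[mu]_(x in D) (e x)%:E = 0)%E ->
  (forall x, D x -> u x <= v x + e x) ->
  ~ {ae mu, forall x, D x -> u x = v x + e x} ->
  (\int[mu]_(x in D) (u x)%:E < \int[mu]_(x in D) (v x)%:E)%E.
Proof.
move=> iu mv ie e0 uve nae.
have mEv : measurable_fun D (EFin \o v) by exact/measurable_EFinP.
have [iv|niv] := pselect (mu.-integrable D (EFin \o v)).
- have iw : mu.-integrable D (EFin \o (fun x => v x + e x - u x)).
    exact: (integrableB mD (integrableD mD iv ie) iu).
  have Ew : (\int[mu]_(x in D) (v x + e x - u x)%:E =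
     \int[mu]_(x in D) (v x)%:E - \int[mu]_(x in D) (u x)%:E)%E.
    rewrite -[X in (X - _)%E]adde0 -e0 -(integralD_EFin mD iv ie).
    by rewrite -(integralB mD (integrableD mD iv ie) iu).
  rewrite -sube_gt0 -Ew lt_neqAle; apply/andP; split; last first.
    by apply: integral_ge0 => x Dx; rewrite lee_fin subr_ge0 uve.
  apply/eqP => w0; apply: nae.
  have /integrableP[/measurable_EFinP mw _] := iw.
  have : {ae mu, forall x, D x -> v x + e x - u x = 0}.
    by apply: ge0_integral0_ae => // x Dx; rewrite subr_ge0 uve.
  by apply: filterS => x + Dx => /(_ Dx)/eqP; rewrite subr_eq0 => /eqP.
- rewrite (integral_pinfty mEv) ?(integrable_lty mD iu)//.
  have := integrable_funeneg mD (integrableB mD iu ie).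
  apply: le_integrable => //; first exact: measurable_funeneg.
  move=> x Dx; rewrite !gee0_abs// !funenegE /=.
  rewrite -!EFin_max lee_fin ge_max !le_max lexx orbT andbT.
  by rewrite lerN2 lerBlDr uve.
Qed.

End integral_comparison.

(** * Borel sets and null points of R^n *)

Section borel_row_vectors.
Context {R : realType} {n : nat} {X : set 'rV[R]_n}.

Lemma open_measurable_rV : open X -> measurable X.
Proof. by move=> oX; exact: sub_sigma_algebra. Qed.

Lemma closed_measurable_rV : closed X -> measurable X.
Proof.
move=> cX; rewrite -[X]setCK; apply: measurableC.
by apply: sub_sigma_algebra; rewrite openC.
Qed.

Lemma within_continuous_measurable_rV {h : 'rV[R]_n -> R} :
  measurable X -> {within X, continuous h} -> measurable_fun X h.
Proof.
move=> mX /continuousP ch.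
apply: (measurability _ (RGenOpens.measurableE R)) => _ [_ [a [b ->]] <-].
have /open_subspaceP[V oV VX] :=
  ch _ (@interval_open R (BRight a) (BLeft b) isT isT).
rewrite setIC -VX; apply: measurableI => //; exact: sub_sigma_algebra.
Qed.

End borel_row_vectors.

Section lebesgue_points.
Context {R : realType} {n : nat}.

Lemma lebesgue_rV_point : (0 < n)%N -> forall v : 'rV[R]_n,
  lebesgue_rV [set v] = 0%E.
Proof.
move=> n0 v.
have -> : [set v] = [set w | forall i, [set v ord0 i] (w ord0 i)].
  apply/seteqP; split => [w -> //|w /= vw].
  by apply/rowP => i; rewrite vw.
rewrite (@lebesgue_rVX R n (fun i => [set v ord0 i])) => [|i]; last first.
  exact: measurable_set1.
rewrite (bigD1 (Ordinal n0))//= lebesgue_measure_set1 mul0e//.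
Qed.

Lemma lebesgue_rV_point_negligible : (0 < n)%N -> forall v : 'rV[R]_n,
  (@lebesgue_rV R n).-negligible [set v].
Proof.
move=> n0 v; exists [set v]; split => //; last exact: lebesgue_rV_point.
apply: closed_measurable_rV; apply: accessible_closed_set1.
by apply: hausdorff_accessible; exact: norm_hausdorff.
Qed.

End lebesgue_points.

(** * Exponential tilting of a density *)

Section exponential_inequalities.
Context {R : realType}.
Implicit Types t : R.

Lemma mulr_expR1B_gt0 t : t != 0 -> 0 < t * (expR t - 1).
Proof.
rewrite neq_lt => /orP[t0|t0].
  by rewrite nmulr_rgt0// subr_lt0 expR_lt1.
by rewrite mulr_gt0// subr_gt0 expR_gt1.
Qed.

Lemma mulr_expR1B_ge0 t : 0 <= t * (expR t - 1).
Proof. by have [->|/mulr_expR1B_gt0/ltW//] := eqVneq t 0; rewrite mul0r. Qed.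

Lemma expR_mul1B_lt1 t : t != 0 -> expR t * (1 - t) < 1.
Proof.
move=> t0; rewrite -ltr_pdivlMl ?expR_gt0// mulr1 -expRN expR_gt1Dx//.
by rewrite oppr_eq0.
Qed.

Lemma expR_mul1B_le1 t : expR t * (1 - t) <= 1.
Proof.
have [->|/expR_mul1B_lt1/ltW//] := eqVneq t 0.
by rewrite expR0 subr0 mulr1.
Qed.

End exponential_inequalities.

Section densities.
Context {R : realType} {n : nat} {X : set 'rV[R]_n}.
Hypothesis cX : closed X.
Let mX : measurable X := closed_measurable_rV cX.
Implicit Types p q h k : 'rV[R]_n -> R.

Lemma density_measurable {p} : is_density X p -> measurable_fun X p.
Proof. by case=> cp _ _; exact: within_continuous_measurable_rV. Qed.

Lemma density_integrable {p} : is_density X p ->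
  lebesgue_rV.-integrable X (EFin \o p).
Proof.
move=> dp; have [_ p0 p1] := dp; apply/integrableP; split.
  by apply/measurable_EFinP; exact: density_measurable.
rewrite (eq_integral (EFin \o p)) ?p1 ?ltry// => x /[!inE] Xx /=.
by rewrite ger0_norm ?p0.
Qed.

Lemma integrable_lincomb {h k} (a b : R) :
  lebesgue_rV.-integrable X (EFin \o h) ->
  lebesgue_rV.-integrable X (EFin \o k) ->
  lebesgue_rV.-integrable X (EFin \o (fun x => a * h x + b * k x)).
Proof.
move=> ih ik.
exact: (integrableD mX (integrableZl mX a ih) (integrableZl mX b ik)).
Qed.

Lemma integral_density_diff {p q} (a : R) : is_density X p -> is_density X q ->
  (\int[lebesgue_rV]_(x in X) (a * p x + - a * q x)%:E = 0)%E.
Proof.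
move=> dp dq; have [_ _ p1] := dp; have [_ _ q1] := dq.
have ip := density_integrable dp; have iq := density_integrable dq.
have := integralD mX (integrableZl mX a ip) (integrableZl mX (- a) iq).
rewrite (integralZl mX ip) (integralZl mX iq) /= p1 q1 !mule1 EFinN subee//.
Qed.

End densities.

Section exponential_tilting.
Context {R : realType} {n : nat} {X : set 'rV[R]_n}.
Context {p q f : 'rV[R]_n -> R} {m a : R}.
Hypotheses (cX : closed X) (dp : is_density X p) (dq : is_density X q).
Hypothesis qE : forall x, X x -> q x = p x * expR (m - f x).
Hypothesis fa : forall x, X x -> a <= f x.
Let mX : measurable X := closed_measurable_rV cX.
Let mp : measurable_fun X p := density_measurable cX dp.
Let mq : measurable_fun X q := density_measurable cX dq.
Let ip : lebesgue_rV.-integrable X (EFin \o p) := density_integrable cX dp.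
Let iq : lebesgue_rV.-integrable X (EFin \o q) := density_integrable cX dq.

(** This is the only source of regularity for [f]: the right-hand side is built
    from two continuous densities. *)
Lemma objective_ln x : X x -> 0 < p x -> f x = m + ln (p x) - ln (q x).
Proof.
by move=> Xx px; rewrite qE// lnM ?posrE ?expR_gt0// expRK; ring.
Qed.

(** Where [p] vanishes nothing is known about [f], but the product is 0 there;
    hence [f] can be replaced everywhere by the logarithmic expression of
    [objective_ln]. *)
Lemma measurable_mul_objective (r : 'rV[R]_n -> R) : measurable_fun X r ->
  (forall x, X x -> p x = 0 -> r x = 0) ->
  measurable_fun X (fun x => r x * f x).
Proof.
move=> mr r0.
have mln (s : 'rV[R]_n -> R) :
    measurable_fun X s -> measurable_fun X (fun x => ln (s x) : R).
  by move=> ms; apply: measurableT_comp ms; exact: measurable_ln.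
apply: (@eq_measurable_fun _ _ _ _ _
  (fun x => r x * (m + ln (p x) - ln (q x)))); last first.
  apply: measurable_funM => //; apply: measurable_funB; last exact: mln.
  by apply: measurable_funD; [exact: measurable_cst|exact: mln].
move=> x /[!inE] Xx; have [_ /(_ _ Xx) + _] := dp.
rewrite le_eqVlt => /orP[/eqP px|px]; first by rewrite r0// !mul0r.
by rewrite -objective_ln.
Qed.

(** Writing [s = f - a >= 0], the product [q * s] is a multiple of
    [p * (s * exp (- s))], and [s * exp (- s) <= 1].  Thus one step of tilting
    makes the expectation finite. *)
Lemma integrable_tilted_objective :
  lebesgue_rV.-integrable X (EFin \o (fun x => q x * f x)).
Proof.
apply: (le_integrable mX _ _
  (integrable_lincomb cX (expR (m - a)) `|a| ip iq)).
  apply/measurable_EFinP; apply: measurable_mul_objective => // x Xx px.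
  by rewrite qE// px mul0r.
move=> x Xx /=; rewrite lee_fin.
have [_ /(_ _ Xx) p0 _] := dp; have [_ /(_ _ Xx) q0 _] := dq.
rewrite [leRHS]ger0_norm; last by rewrite addr_ge0// mulr_ge0// expR_ge0.
rewrite (_ : q x * f x = q x * (f x - a) + a * q x); last by ring.
rewrite (le_trans (ler_normD _ _))// lerD//; last first.
  by rewrite normrM (ger0_norm q0).
have s0 : 0 <= f x - a by rewrite subr_ge0 fa.
rewrite ger0_norm; last by rewrite mulr_ge0.
rewrite qE// (_ : m - f x = (m - a) + - (f x - a)); last by ring.
rewrite expRD mulrCA -mulrA ler_wpM2l ?expR_ge0// -mulrA ler_piMr//.
rewrite expRN ler_pdivrMl ?expR_gt0// mulr1.
by rewrite (le_trans _ (expR_ge1Dx _))// lerDr.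
Qed.

(** Equality case of the strict comparisons: [m] is the constant. *)
Lemma as_constant_of_ae (u v : 'rV[R]_n -> R) :
  (forall x, X x -> 0 < p x -> f x != m -> u x < v x) ->
  {ae lebesgue_rV, forall x, X x -> u x = v x} -> as_constant X p f.
Proof.
move=> uv uvE; exists m; apply: filterS uvE => x + Xx px => /(_ Xx) E.
by apply/eqP/negP => /negP /(uv _ Xx px); rewrite E ltxx.
Qed.

Lemma expectation_tilted_lt : ~ as_constant X p f ->
  (density_expectation X q f < density_expectation X p f)%E.
Proof.
move=> nc.
have gapE x : X x -> p x * f x + (m * q x + - m * p x) - q x * f x =
    p x * ((m - f x) * (expR (m - f x) - 1)).
  by move=> Xx; rewrite qE//; ring.
have mpf : measurable_fun X (fun x => p x * f x).
  exact: measurable_mul_objective.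
apply: (integral_lt_of_le_add_null mX integrable_tilted_objective
  mpf (integrable_lincomb cX m (- m) iq ip)).
- exact: integral_density_diff.
- move=> x Xx; rewrite -subr_ge0 gapE// mulr_ge0 ?mulr_expR1B_ge0//.
  by have [_ ->] := dp.
- move=> /as_constant_of_ae H; apply/nc/H => x Xx px fm.
  by rewrite -subr_gt0 gapE// mulr_gt0// mulr_expR1B_gt0// subr_eq0 eq_sym.
Qed.

(** The hypothesis on [ln (p x)] says that [p] is proportional to
    [exp (- b f)], the form taken by the generation [b] of a uniform initial
    density.  It makes the entropy of [q], like the expectation of [f] under
    [q], finite. *)
Lemma entropy_tilted_lt {b k : R} : 0 <= b ->
  (forall x, X x -> 0 < p x) -> (forall x, X x -> ln (p x) = k - b * f x) ->
  ~ as_constant X p f ->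
  (differential_entropy X q < differential_entropy X p)%E.
Proof.
move=> b0 p0 lnp nc.
(* the multiple of [p - q] for which the gap is a function of [m - f] only *)
pose c := 1 + k - b * m.
have lnq x : X x -> ln (q x) = k - b * f x + (m - f x).
  by move=> Xx; rewrite qE// lnM ?posrE ?expR_gt0 ?p0// expRK lnp.
have gapE x : X x -> p x * - ln (p x) + (c * p x + - c * q x) - q x * - ln (q x)
    = p x * (b * ((m - f x) * (expR (m - f x) - 1)) +
             (1 - expR (m - f x) * (1 - (m - f x)))).
  by move=> Xx; rewrite lnp// lnq// qE// /c; ring.
have iu : lebesgue_rV.-integrable X (EFin \o (fun x => q x * - ln (q x))).
  have := integrable_lincomb cX (1 + b) (- (m + k))
    integrable_tilted_objective iq.
  apply: eq_integrable => // x /[!inE] Xx /=; rewrite lnq//.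
  by congr EFin; ring.
have mv : measurable_fun X (fun x => p x * - ln (p x)).
  apply: measurable_funM => //; apply: measurableT_comp => //.
  apply: measurableT_comp mp; exact: measurable_ln.
apply: (integral_lt_of_le_add_null mX iu mv
  (integrable_lincomb cX c (- c) ip iq)).
- exact: integral_density_diff.
- move=> x Xx; rewrite -subr_ge0 gapE// mulr_ge0 ?(ltW (p0 _ Xx))// addr_ge0//.
    by rewrite mulr_ge0 ?mulr_expR1B_ge0.
  by rewrite subr_ge0 expR_mul1B_le1.
- move=> /as_constant_of_ae H; apply/nc/H => x Xx px fm.
  rewrite -subr_gt0 gapE// mulr_gt0// ltr_wpDl//.
    by rewrite mulr_ge0 ?mulr_expR1B_ge0.
  by rewrite subr_gt0 expR_mul1B_lt1// subr_eq0 eq_sym.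
Qed.

End exponential_tilting.

(** * Charging the minimizer excludes a constant objective *)

Section charged_minimizer.
Context {R : realType} {n : nat} {X : set 'rV[R]_n}.
Context {p q f : 'rV[R]_n -> R} {m : R}.
Hypotheses (n_gt0 : (0 < n)%N) (cX : closed X) (X0 : X 0).
Hypotheses (dp : is_density X p) (dq : is_density X q).
Hypothesis qE : forall x, X x -> q x = p x * expR (m - f x).
Hypothesis f_min : forall x, X x -> x != 0 -> f 0 < f x.
Hypothesis p_charges : charges X p 0.

Lemma objective_lt_near_minimizer {b : R} : f 0 < b ->
  exists2 U : set 'rV[R]_n, open U /\ U 0 &
    forall x, X x -> U x -> 0 < p x /\ f x < b.
Proof.
move=> fb; have [p0 _] := p_charges.
have q0 : 0 < q 0 by rewrite qE// mulr_gt0// expR_gt0.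
have within_cvg (h : 'rV[R]_n -> R) : is_density X h ->
    h x @[x --> within X (nbhs (0 : 'rV[R]_n))] --> h 0.
  by case=> ch _ _; rewrite nbhs_subspace_in//; exact: ch.
have pc := within_cvg p dp; have qc := within_cvg q dq.
have fc : m + ln (p x) - ln (q x) @[x --> within X (nbhs (0 : 'rV[R]_n))] -->
    m + ln (p 0) - ln (q 0).
  apply: cvgB; last by apply: (cvg_comp _ _ qc); exact: continuous_ln.
  apply: cvgD; first exact: cvg_cst.
  by apply: (cvg_comp _ _ pc); exact: continuous_ln.
rewrite -(objective_ln qE)// in fc.
have near_p : \forall x \near within X (nbhs (0 : 'rV[R]_n)), 0 < p x.
  exact: (cvgr_gt _ pc).
have near_f : \forall x \near within X (nbhs (0 : 'rV[R]_n)),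
    m + ln (p x) - ln (q x) < b.
  exact: (cvgr_lt _ fc).
have : \forall x \near within X (nbhs (0 : 'rV[R]_n)),
    0 < p x /\ m + ln (p x) - ln (q x) < b.
  by apply: filterS2 near_p near_f.
rewrite /within /= nearE nbhsE => -[U [oU U0] UP].
exists U => // x Xx Ux; have [px fx] := UP _ Ux Xx; split => //.
by rewrite (objective_ln qE).
Qed.

(** A neighbourhood of 0 in [X] has positive measure, hence so has what is left
    after removing 0 and the null set where [f <> c].  A first such
    neighbourhood provides [x != 0] with [f x = c], whence [f 0 < c]; a second
    one, on which [f < c], is contradictory. *)
Lemma charges_not_as_constant : ~ as_constant X p f.
Proof.
case=> c fc; have [p0 Xcharge] := p_charges.
have neighbour (U : set 'rV[R]_n) : open U -> U 0 ->
    (forall x, X x -> U x -> 0 < p x) ->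
    exists x, [/\ X x, U x, x != 0 & f x = c].
  move=> oU U0 Up; apply: contrapT => nx.
  have := Xcharge _ oU U0; rewrite lt0e => /andP[/eqP + _]; apply.
  have mXU : measurable (X `&` U).
    apply: measurableI; first exact: closed_measurable_rV.
    exact: open_measurable_rV.
  apply/negligibleP => //.
  have null0 := lebesgue_rV_point_negligible n_gt0 (0 : 'rV[R]_n).
  apply: negligibleS (negligibleU fc null0) => x [Xx Ux].
  have [->|x0] := eqVneq x 0; [by right|left => /= H].
  by apply: nx; exists x; split => //; apply: H => //; exact: Up.
have [U [oU U0] UP] :=
  objective_lt_near_minimizer (ltr_pwDr ltr01 (lexx (f 0))).
have [x [Xx Ux x0 fx]] :=
  neighbour U oU U0 (fun x Xx Ux => proj1 (UP x Xx Ux)).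
have [V [oV V0] VP] := objective_lt_near_minimizer (f_min _ Xx x0).
have [y [Xy Vy _ fy]] :=
  neighbour V oV V0 (fun x Xx Vx => proj1 (VP x Xx Vx)).
by have [_] := VP _ Xy Vy; rewrite fx fy ltxx.
Qed.

End charged_minimizer.

(** * Concentration of the generations *)

Section generations.
Context {R : realType} {n : nat} {X : set 'rV[R]_n}.
Context {f : 'rV[R]_n -> R} {p : nat -> 'rV[R]_n -> R}.
Hypotheses (n_gt0 : (0 < n)%N) (cX : closed X) (X0 : X 0).
Hypothesis f_min : forall x, X x -> x != 0 -> f 0 < f x.
Hypothesis p_density : forall g, is_density X (p g).
Hypothesis p_def : forall g,
  proportional X (p g) (fun x => p 0%N x * expR (- (g%:R * f x))).
Let mX : measurable X := closed_measurable_rV cX.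

(** A division-free form, in which [p 0 x] or [p g x] may be 0. *)
Lemma density_ratio g (x y : 'rV[R]_n) : X x -> X y ->
  p g y * p 0%N x = p g x * p 0%N y * expR (f x - f y) ^+ g.
Proof.
move=> Xx Xy; have [c c0 pE] := p_def g.
rewrite !pE// -expRM_natl mulrBr expRD -[expR (g%:R * f x)]invrK -expRN.
by field; rewrite gt_eqF// expR_gt0.
Qed.

Lemma density_gt0 g x : X x -> (0 < p g x) = (0 < p 0%N x).
Proof.
move=> Xx; have [c c0 ->//] := p_def g.
by rewrite pmulr_rgt0// pmulr_lgt0// expR_gt0.
Qed.

Lemma generation_tilt g : exists m, forall x, X x ->
  p g.+1 x = p g x * expR (m - f x).
Proof.
have [c c0 pE] := p_def g; have [d d0 pSE] := p_def g.+1.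
exists (ln (d / c)) => x Xx; rewrite pE// pSE// expRD lnK ?posrE ?divr_gt0//.
rewrite -addn1 natrD mulrDl mul1r opprD expRD.
by field; rewrite gt_eqF.
Qed.

(** The quotients [F g x = p g x / p g 0] are dominated by [F 0], tend to 0
    except at the null point 0, and have integral [1 / p g 0]. *)
Lemma cvg_density_minimizer : 0 < p 0%N 0 -> p g 0 @[g --> \oo] --> +oo.
Proof.
move=> p0; have pg0 g : 0 < p g 0 by rewrite density_gt0.
apply/gtr0_cvgV0; first exact: nearW.
pose F g x := p g x / p g 0.
have FE g x : X x -> F g x = p 0%N x / p 0%N 0 * expR (f 0 - f x) ^+ g.
  move=> Xx; apply/eqP; rewrite /F [eqbRHS]mulrAC eqr_div ?lt0r_neq0//.
  by rewrite (density_ratio g 0 x)// [eqbRHS]mulrC mulrA.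
have F0 g x : X x -> 0 <= F g x.
  by move=> Xx; rewrite divr_ge0 ?(ltW (pg0 _))//; have [_ ->] := p_density g.
have mF g : measurable_fun X (F g).
  by apply: measurable_funM => //; exact: (density_measurable cX).
have iF g : (\int[lebesgue_rV]_(x in X) (F g x)%:E = (p g 0)^-1%:E)%E.
  rewrite /F; under eq_integral do rewrite mulrC EFinM.
  rewrite (integralZl mX (density_integrable cX (p_density g))).
  by have [_ _ ->] := p_density g; rewrite mule1.
have F_dominated g x : X x -> F g x <= F 0%N x.
  move=> Xx; rewrite !FE// expr0 ler_wpM2l//.
    by rewrite divr_ge0 ?(ltW p0)//; have [_ ->] := p_density 0%N.
  rewrite exprn_ile1 ?expR_ge0// expR_le1 subr_le0.
  by have [->//|/(f_min _ Xx)/ltW] := eqVneq x 0.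
have F_cvg0 x : X x -> x != 0 -> F g x @[g --> \oo] --> 0.
  move=> Xx x0; rewrite -(mulr0 (p 0%N x / p 0%N 0)).
  under eq_fun do rewrite FE//.
  apply: cvgMr; apply: cvg_expr.
  by rewrite ger0_norm ?expR_ge0// expR_lt1 subr_lt0 f_min.
have [|||||_ _] := @dominated_convergence _ _ _ lebesgue_rV X mX
    (fun g x => (F g x)%:E) (cst 0%E) (EFin \o F 0%N).
- by move=> g; apply/measurable_EFinP.
- exact: measurable_cst.
- have null0 := lebesgue_rV_point_negligible n_gt0 (0 : 'rV[R]_n).
  apply: negligibleS null0 => x /= H.
  apply: contrapT => /eqP x0; apply: H => Xx.
  by apply: cvg_EFin; [exact: nearW|exact: F_cvg0].
- exact: (integrableZr mX (p 0%N 0)^-1 (density_integrable cX (p_density 0%N))).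
- apply: aeW => x g Xx /=; rewrite lee_fin ger0_norm ?F0//.
  exact: F_dominated.
rewrite integral0 (_ : [sequence _]_n = fun g => (p g 0)^-1%:E).
  by move=> /fine_cvgP[].
by apply/funext => g; rewrite -iF.
Qed.

(** Let [f 0 < b < f x] and let [V] be a neighbourhood of 0 in [X] on which
    [f < b].  For [y] in [V], [density_ratio] gives
    [p g x * p 0 y <= p 0 x * exp (b - f x) ^ g * p g y].  Integrated over [V],
    which has a positive mass [M] under [p 0] and a mass at most 1 under
    [p g], this bounds [p g x] by a geometric sequence. *)
Lemma cvg_density_elsewhere x : charges X (p 0%N) 0 -> X x -> x != 0 ->
  p g x @[g --> \oo] --> (0 : R).
Proof.
move=> p_charges Xx x0; have [_ Xcharge] := p_charges.
have [m p1E] := generation_tilt 0.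
have [f0b bfx] := midf_lt (f_min _ Xx x0).
set b := (f 0 + f x) / 2 in f0b bfx.
have [U [oU U0] UP] := objective_lt_near_minimizer X0
  (p_density 0%N) (p_density 1%N) p1E p_charges f0b.
set V := X `&` U.
have mV : measurable V.
  by apply: measurableI => //; exact: open_measurable_rV.
have VX : V `<=` X by move=> y [].
have ipV g : lebesgue_rV.-integrable V (EFin \o p g).
  exact: integrableS (density_integrable cX (p_density g)).
pose M := fine (\int[lebesgue_rV]_(y in V) (p 0%N y)%:E).
have ME : M%:E = (\int[lebesgue_rV]_(y in V) (p 0%N y)%:E)%E.
  by rewrite fineK// (integrable_fin_num mV (ipV 0%N)).
have M0 : 0 < M.
  rewrite -lte_fin ME lt_neqAle; apply/andP; split; last first.
    apply: integral_ge0 => y [Xy Uy]; rewrite lee_fin ltW//.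
    by have [] := UP y Xy Uy.
  apply/eqP => /esym H.
  have := Xcharge _ oU U0; rewrite lt0e => /andP[/eqP + _]; apply.
  have /integrableP[/measurable_EFinP mp0 _] := ipV 0%N.
  apply/negligibleP => //.
  have pge0 y : V y -> 0 <= p 0%N y.
    by move=> /VX; have [_ + _] := p_density 0%N; exact.
  apply: negligibleS (ge0_integral0_ae mV mp0 pge0 H) => y [Xy Uy] /= yP.
  by have [] := UP y Xy Uy; rewrite yP// ltxx.
have V_mass g : (\int[lebesgue_rV]_(y in V) (p g y)%:E <= 1)%E.
  have [_ pg0 <-] := p_density g; apply: ge0_subset_integral => //.
  by apply/measurable_EFinP; exact: (density_measurable cX).
have p_le g : p g x <= p 0%N x / M * expR (b - f x) ^+ g.
  rewrite mulrAC ler_pdivlMr// -lee_fin EFinM ME.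
  rewrite -(integralZl mV (ipV 0%N)).
  apply: (@le_trans _ _ (\int[lebesgue_rV]_(y in V)
      ((p 0%N x * expR (b - f x) ^+ g)%:E * (p g y)%:E))%E).
    apply: le_integral => //.
    - exact: integrableZl (ipV 0%N).
    - exact: integrableZl (ipV g).
    move=> y /[!inE] -[Xy Uy]; have [py fy] := UP y Xy Uy.
    rewrite -!EFinM lee_fin.
    rewrite [leRHS](_ : _ = p g y * p 0%N x * expR (b - f x) ^+ g);
      last by ring.
    rewrite density_ratio// -mulrA -exprMn -expRD ler_peMr//.
      have [_ px0 _] := p_density g; have [_ py0 _] := p_density 0%N.
      by rewrite mulr_ge0 ?px0 ?py0.
    by rewrite exprn_ege1// -expR0 ler_expR; lra.
  rewrite (integralZl mV (ipV g)) -[leRHS]mule1 lee_wpmul2l ?V_mass//.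
  rewrite lee_fin mulr_ge0 ?exprn_ge0 ?expR_ge0//.
  by have [_ ->] := p_density 0%N.
have bound_cvg0 : p 0%N x / M * expR (b - f x) ^+ g @[g --> \oo] --> (0 : R).
  rewrite -(mulr0 (p 0%N x / M)); apply: cvgMr; apply: cvg_expr.
  by rewrite ger0_norm ?expR_ge0// expR_lt1 subr_lt0.
apply: squeeze_cvgr (cvg_cst (0 : R)) bound_cvg0.
by apply: nearW => g; rewrite p_le andbT; have [_ ->] := p_density g.
Qed.

End generations.

(** * Monotonicity along the generations *)

Section monotonicity.
Context {R : realType} {n : nat} {X : set 'rV[R]_n}.
Context {f : 'rV[R]_n -> R} {p : nat -> 'rV[R]_n -> R}.
Hypotheses (n_gt0 : (0 < n)%N) (cX : closed X) (X0 : X 0).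
Hypothesis f_min : forall x, X x -> x != 0 -> f 0 < f x.
Hypothesis p_density : forall g, is_density X (p g).
Hypothesis p_def : forall g,
  proportional X (p g) (fun x => p 0%N x * expR (- (g%:R * f x))).

Lemma generation_not_as_constant g :
  charges X (p 0%N) 0 \/ ~ as_constant X (p 0%N) f -> ~ as_constant X (p g) f.
Proof.
have [m p1E] := generation_tilt p_def 0.
move=> nc; have {nc} : ~ as_constant X (p 0%N) f.
  case: nc => // p_charges.
  exact: (charges_not_as_constant n_gt0 cX X0
    (p_density 0%N) (p_density 1%N) p1E).
apply: contra_not => -[c fc]; exists c; apply: filterS fc => x + Xx px.
by apply; rewrite ?(density_gt0 p_def).
Qed.

Lemma uniform_density_gt0 : uniform_on X (p 0%N) ->
  forall g x, X x -> 0 < p g x.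
Proof.
move=> [c pc] g x Xx; rewrite (density_gt0 p_def)// pc//.
have [_ p0 p1] := p_density 0%N.
rewrite lt0r -{2}(pc 0 X0) p0// andbT; apply/eqP => c0; move: p1.
rewrite (eq_integral (cst 0%E)) ?integral0 => [/esym/eqP|y /[!inE] Xy].
  by rewrite onee_eq0.
by rewrite pc// c0.
Qed.

Lemma ln_uniform_generation : uniform_on X (p 0%N) ->
  forall g, exists k, forall x, X x -> ln (p g x) = k - g%:R * f x.
Proof.
move=> p_unif g; have [c pc] := p_unif; have [d d0 pE] := p_def g.
have c0 : 0 < c by rewrite -(pc 0 X0) uniform_density_gt0.
exists (ln (d * c)) => x Xx; rewrite pE// pc// mulrA.
by rewrite lnM ?posrE ?expR_gt0 ?mulr_gt0// expRK.
Qed.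

End monotonicity.

Theorem theorem2 (R : realType) (n : nat) (X : set 'rV[R]_n)
    (f : 'rV[R]_n -> R) (p : nat -> 'rV[R]_n -> R)
    (n_gt0 : (0 < n)%N)
    (X_closed : closed X)
    (X0 : X 0)
    (f_min : forall x, X x -> x != 0 -> f 0 < f x)
    (p_density : forall g, is_density X (p g))
    (p_def : forall g,
       proportional X (p g) (fun x => p 0%N x * expR (- (g%:R * f x)))) :
  [/\ (charges X (p 0%N) 0 ->
        p g 0 @[g --> \oo] --> +oo /\
        forall x, X x -> x != 0 -> p g x @[g --> \oo] --> (0 : R)),
      (charges X (p 0%N) 0 \/ ~ as_constant X (p 0%N) f ->
        forall g, (density_expectation X (p g.+1) f <
                   density_expectation X (p g) f)%E) &
      (uniform_on X (p 0%N) ->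
        charges X (p 0%N) 0 \/ ~ as_constant X (p 0%N) f ->
        forall g, (differential_entropy X (p g.+1) <
                   differential_entropy X (p g))%E)].
Proof.
have f_ge : forall x, X x -> f 0 <= f x.
  by move=> x Xx; have [->//|/(f_min _ Xx)/ltW] := eqVneq x 0.
split=> [p_charges|nc g|p_unif nc g].
- split=> [|x Xx x0]; last first.
    exact: (cvg_density_elsewhere X_closed X0 f_min p_density p_def).
  apply: (cvg_density_minimizer n_gt0 X_closed X0 f_min p_density p_def).
  by have [] := p_charges.
- have [m pE] := generation_tilt p_def g.
  apply: (expectation_tilted_lt X_closed _ _ pE f_ge) => //.
  exact: (generation_not_as_constant n_gt0 X_closed X0 f_min p_density p_def).
- have [m pE] := generation_tilt p_def g.
  have [k lnp] := ln_uniform_generation X0 p_density p_def p_unif g.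
  have p_gt0 := uniform_density_gt0 X0 p_density p_def p_unif g.
  apply: (entropy_tilted_lt X_closed _ _ pE f_ge (ler0n _ g) p_gt0 lnp) => //.
  exact: (generation_not_as_constant n_gt0 X_closed X0 f_min p_density p_def).
Qed.
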